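(* Let $V$ be a finite-dimensional vector space and let $F:\wedge^n V\longrightarrow V$ be a linear map. Then $(V,F)$ is an $n$-Lie algebra if and only if the graph $G_F=\{F^\sharp(\mathfrak u)+\mathfrak u : \mathfrak u\in\wedge^{n-1}V\}\subset \mathfrak{gl}(V)\oplus\wedge^{n-1}V$ is a Leibniz subalgebra of the Leibniz algebra $(\mathfrak{gl}(V)\oplus\wedge^{n-1}V,\{\cdot,\cdot\})$.
   Context: Let $n\ge 2$ be an integer; all vector spaces are over a fixed ground field. $\mathfrak{gl}(V)$ is the space of linear endomorphisms of $V$ with commutator $[A,B]=AB-BA$. For $A\in\mathfrak{gl}(V)$, $\mathcal L_A$ is the map on $\otimes^{n-1}V$ given by $\mathcal L_A(v_1\otimes\cdots\otimes v_{n-1})=\sum_{i=1}^{n-1}v_1\otimes\cdots\otimes Av_i\otimes\cdots\otimes v_{n-1}$; the same symbol denotes the induced map on $\wedge^{n-1}V$. The bilinear bracket on $\mathfrak{gl}(V)\oplus\wedge^{n-1}V$ is $\{A+\mathfrak u,B+\mathfrak v\}=[A,B]+\mathcal L_A\mathfrak v$. It makes $\mathfrak{gl}(V)\oplus\wedge^{n-1}V$ a (left) Leibniz algebra, i.e. $\{e_1,\{e_2,e_3\}\}=\{\{e_1,e_2\},e_3\}+\{e_2,\{e_1,e_3\}\}$. A Leibniz subalgebra is a linear subspace closed under the bracket. For a linear map $F:\wedge^nV\to V$, the linear map $F^\sharp:\wedge^{n-1}V\to\mathfrak{gl}(V)$ is defined by $F^\sharp(\mathfrak u)(u)=F(\mathfrak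 u\wedge u)$ for $\mathfrak u\in\wedge^{n-1}V$, $u\in V$. An $n$-Lie algebra is a vector space $\mathfrak g$ with an $n$-multilinear skew-symmetric bracket $[\cdot,\cdots,\cdot]_{\mathfrak g}:\wedge^n\mathfrak g\to\mathfrak g$ such that for all $u_i,v_i\in\mathfrak g$: $[u_1,\dots,u_{n-1},[v_1,\dots,v_n]_{\mathfrak g}]_{\mathfrak g}=\sum_{i=1}^n[v_1,\dots,[u_1,\dots,u_{n-1},v_i]_{\mathfrak g},\dots,v_n]_{\mathfrak g}$. ''$(V,F)$ is an $n$-Lie algebra'' means that the bracket $[v_1,\dots,v_n]=F(v_1\wedge\cdots\wedge v_n)$ satisfies this identity. *)

(* Defs.v *)
From HB Require Import structures.
From mathcomp Require Import freeg.
From mathcomp Require Import all_boot all_order all_algebra.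
From mathcomp Require Import generic_quotient ring_quotient boolp.

Set Implicit Arguments.
Unset Strict Implicit.
Unset Printing Implicit Defensive.

Import GRing.Theory.

Local Open Scope ring_scope.
Local Open Scope quotient_scope.

Section LmodQuotient.
Variables (K : fieldType) (T : lmodType K) (S : T -> Prop).

Inductive lspan : T -> Prop :=
| lspan0 : lspan 0
| lspanZD a x y : S x -> lspan y -> lspan (a *: x + y).

Lemma lspanD x y : lspan x -> lspan y -> lspan (x + y).
Proof.
move=> Sx Sy; elim: Sx => [|a u v Su _ IH]; first by rewrite add0r.
by rewrite -addrA; apply: lspanZD.
Qed.

Lemma lspanZ a x : lspan x -> lspan (a *: x).
Proof.
elim=> [|b u v Su _ IH]; first by rewrite scaler0; apply: lspan0.
by rewrite scalerDr scalerA; apply: lspanZD.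
Qed.

Lemma lspan_sub x : S x -> lspan x.
Proof.
by move=> Sx; rewrite -[x]scale1r -[_ *: _]addr0; apply: lspanZD lspan0.
Qed.

Definition lspanb (x : T) : bool := `[< lspan x >].

Lemma lspanb_closed : zmod_closed lspanb.
Proof.
split=> [|x y /asboolP Sx /asboolP Sy]; apply/asboolP; first exact: lspan0.
by rewrite -scaleN1r; apply/lspanD/lspanZ.
Qed.

HB.instance Definition _ := GRing.isZmodClosed.Build T lspanb lspanb_closed.

Local Notation zquot :=
  (@Quotient.quot T (GRing.ZmodClosed.clone T lspanb _)).

Definition lquot : Type := zquot.

HB.instance Definition _ := GRing.Zmodule.on lquot.

Definition lpi (x : T) : lquot := \pi_zquot x.
Definition lrepr (q : lquot) : T := repr (q : zquot).

Lemma lreprK : cancel lrepr lpi.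
Proof. exact: reprK. Qed.

Lemma lpi_eq x y : lpi x = lpi y <-> lspan (x - y).
Proof.
apply: (iff_trans (rwP eqP)); rewrite /lpi -Quotient.idealrBE.
by split=> /asboolP.
Qed.

Lemma lpiB : {morph lpi : x y / x - y}.
Proof. exact: (raddfB \pi_zquot). Qed.

Definition lquot_scale (a : K) (q : lquot) : lquot := lpi (a *: lrepr q).

Lemma lpiZ_subproof a x : lquot_scale a (lpi x) = lpi (a *: x).
Proof.
apply/lpi_eq; rewrite -scalerBr; apply: lspanZ.
by apply/lpi_eq; rewrite lreprK.
Qed.

Lemma lpiD_subproof : {morph lpi : x y / x + y}.
Proof. exact: (raddfD \pi_zquot). Qed.

Fact lquot_scaleA a b q :
  lquot_scale a (lquot_scale b q) = lquot_scale (a * b) q.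
Proof. by rewrite -[q]lreprK !lpiZ_subproof scalerA. Qed.

Fact lquot_scale1 : left_id 1 lquot_scale.
Proof. by move=> q; rewrite -[q]lreprK lpiZ_subproof scale1r. Qed.

Fact lquot_scaleDr : right_distributive lquot_scale +%R.
Proof.
move=> a p q; rewrite -[p]lreprK -[q]lreprK -lpiD_subproof !lpiZ_subproof.
by rewrite scalerDr lpiD_subproof.
Qed.

Fact lquot_scaleDl q : {morph lquot_scale^~ q : a b / a + b}.
Proof.
by move=> a b; rewrite -[q]lreprK !lpiZ_subproof scalerDl lpiD_subproof.
Qed.

HB.instance Definition _ := GRing.Zmodule_isLmodule.Build K lquot
  lquot_scaleA lquot_scale1 lquot_scaleDr lquot_scaleDl.

Fact lpi_is_linear : linear lpi.
Proof. by move=> a x y; rewrite lpiD_subproof -lpiZ_subproof. Qed.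

HB.instance Definition _ := GRing.isLinear.Build K T lquot _ lpi lpi_is_linear.

(* The map induced by [f] on the quotient; it is only meaningful when the
   linear map [f] vanishes on [S], see [lquot_lift_pi]. *)
Definition lquot_lift (U : Type) (f : T -> U) (q : lquot) : U := f (lrepr q).

Section Lift.
Variables (U : lmodType K) (f : T -> U).
Hypotheses (f_lin : linear f) (f0 : forall x, S x -> f x = 0).

Lemma lquot_lift_pi x : lquot_lift f (lpi x) = f x.
Proof.
have f00 : f 0 = 0.
  by have := f_lin (-1) 0 0; rewrite scaler0 addr0 scaleN1r addNr.
have fspan y : lspan y -> f y = 0.
  elim=> [//|a u v Su _ IH].
  by rewrite f_lin IH f0 // scaler0 addr0.
have : f (lrepr (lpi x) - x) = 0.
  by apply/fspan/lpi_eq; rewrite lreprK.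
rewrite -scaleN1r addrC f_lin scaleN1r => /eqP.
by rewrite addrC subr_eq0 => /eqP.
Qed.

Lemma lquot_lift_linear : linear (lquot_lift f).
Proof.
move=> a p q; rewrite -[p]lreprK -[q]lreprK -linearP !lquot_lift_pi.
exact: f_lin.
Qed.

End Lift.

End LmodQuotient.

Section Families.
Variables (T : Type) (k : nat).

Definition upd (v : {ffun 'I_k -> T}) (i : 'I_k) (x : T) : {ffun 'I_k -> T} :=
  [ffun j => if j == i then x else v j].

Definition frcons (v : {ffun 'I_k -> T}) (x : T) : {ffun 'I_k.+1 -> T} :=
  [ffun i => if unlift ord_max i is Some j then v j else x].

End Families.

Section Multilinear.
Variables (K : fieldType) (V U : lmodType K) (k : nat).
Variable f : {ffun 'I_k -> V} -> U.

Definition multilinear : Prop := forall (v : {ffun 'I_k -> V}) i a x y,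
  f (upd v i (a *: x + y)) = a *: f (upd v i x) + f (upd v i y).

Definition alternating : Prop := forall (v : {ffun 'I_k -> V}) i j,
  i != j -> v i = v j -> f v = 0.

End Multilinear.

(* The k-th tensor power of V is the free vector space on the k-tuples of V
   modulo multilinearity; the k-th exterior power is the quotient of the tensor
   power by the span of the pure tensors that have two equal entries. *)
Section Powers.
Variables (K : fieldType) (k : nat) (V : lmodType K).
Implicit Types (v : {ffun 'I_k -> V}) (i j : 'I_k).

Local Notation freeV := {freeg {ffun 'I_k -> V} / K}.
Local Notation gen v := (<< v >> : freeV).

Definition tensor_rel (t : freeV) : Prop := exists v i a x y,
  t = gen (upd v i (a *: x + y))
      - (a *: gen (upd v i x) + gen (upd v i y)).

Definition tensor : Type := lquot tensor_rel.
HB.instance Definition _ := GRing.Lmodule.on tensor.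

Definition tens v : tensor := lpi tensor_rel (gen v).

Definition ext_rel (t : tensor) : Prop := exists v i j,
  [/\ i != j, v i = v j & t = tens v].

Definition ext : Type := lquot ext_rel.
HB.instance Definition _ := GRing.Lmodule.on ext.

Definition wedge v : ext := lpi ext_rel (tens v).

(* The maps induced on the tensor power by a map on tuples, and on the exterior
   power by a map on the tensor power; see [tlift_tens] and [elift_wedge]. *)
Definition tlift (U : lmodType K) (f : {ffun 'I_k -> V} -> U) : tensor -> U :=
  lquot_lift (fglift f).
Definition elift (U : lmodType K) (f : tensor -> U) : ext -> U :=
  lquot_lift f.

End Powers.

Arguments tensor {K} k V.
Arguments ext {K} k V.

Section PowersTheory.
Variables (K : fieldType) (k : nat) (V : lmodType K).
Implicit Types (v : {ffun 'I_k -> V}) (i j : 'I_k).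

Lemma fglift_linear (X : choiceType) (U : lmodType K) (f : X -> U) :
  linear (fglift f : {freeg X / K} -> U).
Proof.
pose g : {freeg X / K} -> U := fglift f.
have gB : {morph g : x y / x - y} by exact: (lift_is_additive f).
have g0 : g 0 = 0 by rewrite -[0 in LHS](subrr 0) gB subrr.
have gN y : g (- y) = - g y by rewrite -sub0r gB g0 sub0r.
have gD : {morph g : x y / x + y}.
  by move=> x y; rewrite -[y in LHS]opprK gB gN opprK.
have gs I (r : seq I) (F : I -> {freeg X / K}) :
    g (\sum_(x <- r) F x) = \sum_(x <- r) g (F x) by apply: (big_morph g gD g0).
move=> a x y; rewrite -/g gD; congr (_ + _).
rewrite -[in RHS](freeg_sumE x) [a *: x]/(fgscale a x) /fgscale !gs scaler_sumr.
by apply: eq_bigr => z _; rewrite /g !liftU scalerA.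
Qed.

Lemma tens_multilinear : multilinear (@tens K k V).
Proof.
move=> v i a x y; rewrite /tens -linearP; apply/lpi_eq/lspan_sub.
by exists v, i, a, x, y.
Qed.

Lemma wedge_multilinear : multilinear (@wedge K k V).
Proof. by move=> v i a x y; rewrite /wedge tens_multilinear linearP. Qed.

Lemma wedge_alternating : alternating (@wedge K k V).
Proof.
move=> v i j nij vij; rewrite /wedge -(linear0 (lpi (@ext_rel K k V))).
by apply/lpi_eq/lspan_sub; rewrite subr0; exists v, i, j.
Qed.

Section Lifts.
Variables (U : lmodType K).

Lemma tlift_tens (f : {ffun 'I_k -> V} -> U) v :
  multilinear f -> tlift f (tens v) = f v.
Proof.
move=> f_ml; rewrite /tlift /tens lquot_lift_pi ?liftU ?scale1r //.
  exact: fglift_linear.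
move=> _ [w [i [a [x [y ->]]]]]; rewrite lift_is_additive fglift_linear.
by rewrite !liftU !scale1r f_ml subrr.
Qed.

Lemma tlift_linear (f : {ffun 'I_k -> V} -> U) :
  multilinear f -> linear (tlift f).
Proof.
move=> f_ml; apply: lquot_lift_linear; first exact: fglift_linear.
move=> _ [w [i [a [x [y ->]]]]]; rewrite lift_is_additive fglift_linear.
by rewrite !liftU !scale1r f_ml subrr.
Qed.

Lemma elift_wedge (f : tensor k V -> U) v :
  linear f -> alternating (f \o @tens K k V) -> elift f (wedge v) = f (tens v).
Proof.
move=> f_lin f_alt; rewrite /elift /wedge lquot_lift_pi //.
by move=> _ [w [i [j [nij wij ->]]]]; apply: f_alt nij wij.
Qed.

Lemma elift_linear (f : tensor k V -> U) :
  linear f -> alternating (f \o @tens K k V) -> linear (elift f).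
Proof.
move=> f_lin f_alt; apply: lquot_lift_linear => //.
by move=> _ [w [i [j [nij wij ->]]]]; apply: f_alt nij wij.
Qed.

Lemma eq_tensor_linear (f g : {linear tensor k V -> U}) :
  (forall v, f (tens v) = g (tens v)) -> f =1 g.
Proof.
move=> fg t; rewrite -[t]lreprK; move: (lrepr t) => {}t.
rewrite -[t]freeg_sumE !linear_sum; apply: eq_bigr => v _.
have -> : << coeff v t *g v >> = coeff v t *: << v >> :> {freeg _ / K}.
  by apply/eqP/freeg_eqP => w; rewrite coeffZ !coeffU mul1r.
by rewrite !linearZ -/(tens v); congr (_ *: _); apply: fg.
Qed.

Lemma eq_ext_linear (f g : {linear ext k V -> U}) :
  (forall v, f (wedge v) = g (wedge v)) -> f =1 g.
Proof.
move=> fg t; rewrite -[t]lreprK.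
exact: (@eq_tensor_linear (f \o lpi _ : {linear _ -> _})
          (g \o lpi _ : {linear _ -> _}) fg).
Qed.

Theorem ext_universal (f : {ffun 'I_k -> V} -> U) :
    multilinear f -> alternating f ->
  exists2 g : {linear ext k V -> U}, (forall v, g (wedge v) = f v) &
    forall h : {linear ext k V -> U}, (forall v, h (wedge v) = f v) -> h =1 g.
Proof.
move=> f_ml f_alt; have t_lin := tlift_linear f_ml.
have t_alt : alternating (tlift f \o @tens K k V).
  by move=> v i j nij vij /=; rewrite tlift_tens //; apply: f_alt nij vij.
pose g := elift (tlift f).
pose Lg := GRing.isLinear.Build K _ U _ g (elift_linear t_lin t_alt).
pose G : {linear ext k V -> U} := HB.pack g Lg.
have GE v : G (wedge v) = f v by rewrite [LHS]elift_wedge // tlift_tens.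
by exists G => // h hE; apply: eq_ext_linear => v; rewrite hE GE.
Qed.

End Lifts.

End PowersTheory.

Section UpdTheory.
Variables (T : Type) (k : nat).
Implicit Types (v : {ffun 'I_k -> T}) (i j : 'I_k) (x y : T).

Lemma updE v i x j : upd v i x j = if j == i then x else v j.
Proof. by rewrite ffunE. Qed.

Lemma upd_eq v i x : upd v i x i = x.
Proof. by rewrite updE eqxx. Qed.

Lemma upd_upd v i x y : upd (upd v i x) i y = upd v i y.
Proof. by apply/ffunP => j; rewrite !updE; case: eqP. Qed.

Lemma updC v i j x y : i != j -> upd (upd v i x) j y = upd (upd v j y) i x.
Proof.
move=> nij; apply/ffunP => l; rewrite !updE.
by case: (eqVneq l j) => // ->; rewrite eq_sym (negPf nij).
Qed.

Lemma upd_id v i : upd v i (v i) = v.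
Proof. by apply/ffunP => j; rewrite updE; case: eqP => // ->. Qed.

End UpdTheory.

Section FrconsTheory.
Variables (T : Type) (k : nat).
Implicit Types (v : {ffun 'I_k -> T}) (i : 'I_k) (x y : T).

Lemma frcons_lift v x i : frcons v x (lift ord_max i) = v i.
Proof. by rewrite ffunE liftK. Qed.

Lemma frcons_max v x : frcons v x ord_max = x.
Proof. by rewrite ffunE unlift_none. Qed.

Lemma frcons_upd v i x y :
  frcons (upd v i x) y = upd (frcons v y) (lift ord_max i) x.
Proof.
apply/ffunP => j; rewrite updE; case: (unliftP ord_max j) => [l ->|->].
  by rewrite !frcons_lift updE (inj_eq lift_inj).
by rewrite !frcons_max (negPf (neq_lift _ _)).
Qed.

Lemma upd_frcons_max v x y : upd (frcons v x) ord_max y = frcons v y.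
Proof.
apply/ffunP => j; rewrite updE; case: (unliftP ord_max j) => [l ->|->].
  by rewrite !frcons_lift eq_sym (negPf (neq_lift _ _)).
by rewrite eqxx !frcons_max.
Qed.

End FrconsTheory.

Section AlternatingTheory.
Variables (K : fieldType) (k : nat) (V U : lmodType K).
Variable f : {ffun 'I_k -> V} -> U.
Hypotheses (f_ml : multilinear f) (f_alt : alternating f).

Lemma multilinearD v i x y :
  f (upd v i (x + y)) = f (upd v i x) + f (upd v i y).
Proof. by rewrite -[x]scale1r f_ml !scale1r. Qed.

Lemma alternating_skew v i j x y : i != j ->
  f (upd (upd v i x) j y) + f (upd (upd v i y) j x) = 0.
Proof.
move=> nij.
have dbl z : f (upd (upd v i z) j z) = 0.
  by apply: (f_alt nij); rewrite upd_eq updE (negPf nij) upd_eq.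
have H := dbl (x + y); rewrite multilinearD in H.
rewrite 2!(updC v _ _ nij) !multilinearD -!(updC v _ _ nij) !dbl in H.
by rewrite add0r addr0 addrC in H.
Qed.

End AlternatingTheory.

Section Induced.
Variables (K : fieldType) (V : vectType K).
Implicit Types (A B : 'End(V)) (u : V).

Section Deriv.
Variables (k : nat) (U : lmodType K) (f : {ffun 'I_k -> V} -> U).
Hypotheses (f_ml : multilinear f).

Lemma deriv_multilinear A :
  multilinear (fun v => \sum_(i < k) f (upd v i (A (v i)))).
Proof.
move=> v i a x y /=; rewrite scaler_sumr -big_split /=; apply: eq_bigr => l _.
case: (eqVneq l i) => [->|nli].
  by rewrite !upd_upd !upd_eq linearP f_ml.
by rewrite !updE (negPf nli) !(updC v _ _ (_ : i != l)) ?f_ml // eq_sym.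
Qed.

Lemma deriv_alternating A : alternating f ->
  alternating (fun v => \sum_(i < k) f (upd v i (A (v i)))).
Proof.
move=> f_alt v i j nij vij /=; rewrite (bigD1 i) //= (bigD1 j) 1?eq_sym //=.
rewrite big1 ?addr0 => [|l /andP[nli nlj]]; last first.
  by apply: (f_alt _ i j nij); rewrite !updE eq_sym (negPf nli) eq_sym (negPf nlj).
have := alternating_skew f_ml f_alt v (A (v i)) (v j) nij.
have -> : upd v i (v j) = v by rewrite -vij upd_id.
by rewrite updC // upd_id -vij.
Qed.

End Deriv.

(* L_A on the tensor power, and the map it induces on the exterior power. *)
Definition tensor_deriv k A : tensor k V -> tensor k V :=
  tlift (fun v => \sum_(i < k) tens (upd v i (A (v i)))).

Definition ext_deriv k A : ext k V -> ext k V :=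
  elift (fun t : tensor k V => lpi (@ext_rel K k V) (tensor_deriv A t)).

Lemma tensor_deriv_tens k A v :
  tensor_deriv A (tens v) = \sum_(i < k) tens (upd v i (A (v i))).
Proof. exact/tlift_tens/deriv_multilinear/tens_multilinear. Qed.

Fact tensor_deriv_linear k A : linear (@tensor_deriv k A).
Proof. exact/tlift_linear/deriv_multilinear/tens_multilinear. Qed.

HB.instance Definition _ k A := GRing.isLinear.Build K _ _ _
  (@tensor_deriv k A) (@tensor_deriv_linear k A).

Fact ext_deriv_subproof k A :
  linear (fun t : tensor k V => lpi (@ext_rel K k V) (tensor_deriv A t)) /\
  alternating (fun v => lpi (@ext_rel K k V) (tensor_deriv A (tens v))).
Proof.
split=> [a x y|v i j nij vij]; first by rewrite !linearP.
rewrite tensor_deriv_tens linear_sum.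
exact: (deriv_alternating (@wedge_multilinear K k V) A
          (@wedge_alternating K k V) nij vij).
Qed.

Lemma ext_deriv_wedge k A v :
  ext_deriv A (wedge v) = \sum_(i < k) wedge (upd v i (A (v i))).
Proof.
have [lin alt] := ext_deriv_subproof k A.
by rewrite /ext_deriv elift_wedge // tensor_deriv_tens linear_sum.
Qed.

Fact ext_deriv_linear k A : linear (@ext_deriv k A).
Proof.
by have [lin alt] := ext_deriv_subproof k A; apply: elift_linear lin alt.
Qed.

HB.instance Definition _ k A := GRing.isLinear.Build K _ _ _
  (@ext_deriv k A) (@ext_deriv_linear k A).

(* Right multiplication by a vector, x |-> x /\ u. *)
Definition wedger k (x : ext k V) (u : V) : ext k.+1 V :=
  elift (tlift (fun v => wedge (frcons v u))) x.

Fact wedger_subproof k u :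
  multilinear (fun v : {ffun 'I_k -> V} => wedge (frcons v u)) /\
  alternating (fun v : {ffun 'I_k -> V} => wedge (frcons v u)).
Proof.
split=> [v i a x y|v i j nij vij].
  by rewrite !frcons_upd wedge_multilinear.
apply: (@wedge_alternating _ _ _ _ (lift ord_max i) (lift ord_max j)).
  by rewrite (inj_eq lift_inj).
by rewrite !frcons_lift.
Qed.

Lemma wedger_wedge k (v : {ffun 'I_k -> V}) u :
  wedger (wedge v) u = wedge (frcons v u).
Proof.
have [ml alt] := wedger_subproof k u.
rewrite /wedger elift_wedge ?tlift_tens //; first exact: tlift_linear.
by move=> w i j nij wij /=; rewrite tlift_tens //; apply: alt nij wij.
Qed.

Fact wedger_linearl k u : linear ((@wedger k)^~ u).
Proof.
have [ml alt] := wedger_subproof k u.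
apply: elift_linear; first exact: tlift_linear.
by move=> w i j nij wij /=; rewrite tlift_tens //; apply: alt nij wij.
Qed.

Fact wedger_linearr k (x : ext k V) : linear (wedger x).
Proof.
move=> a u w; pose W z := GRing.isLinear.Build K _ _ _ _ (@wedger_linearl k z).
pose G z : {linear ext k V -> ext k.+1 V} := HB.pack ((@wedger k)^~ z) (W z).
apply: (@eq_ext_linear K k V _ (G (a *: u + w))
  (a \*: G u \+ G w : {linear _ -> _})) => v /=.
rewrite !wedger_wedge -(upd_frcons_max v 0) wedge_multilinear.
by rewrite !upd_frcons_max.
Qed.

HB.instance Definition _ k x := GRing.isLinear.Build K _ _ _
  (@wedger k x) (@wedger_linearr k x).

Definition sharp k (F : {linear ext k.+1 V -> V}) (x : ext k V) : 'End(V) :=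
  linfun (fun u => F (wedger x u)).

Lemma sharpE k (F : {linear ext k.+1 V -> V}) (x : ext k V) u :
  sharp F x u = F (wedger x u).
Proof. exact: (lfunE (F \o wedger x : {linear V -> V})). Qed.

Definition commutator A B : 'End(V) := ((A \o B) - (B \o A))%VF.

Lemma commutatorE A B u : commutator A B u = A (B u) - B (A u).
Proof.
by rewrite add_lfunE opp_lfunE !comp_lfunE.
Qed.

(* The bracket on gl(V) (+) /\^k V; here k plays the role of n - 1. *)
Definition omni_bracket k (e1 e2 : 'End(V) * ext k V) : 'End(V) * ext k V :=
  (commutator e1.1 e2.1, ext_deriv e1.1 e2.2).

Definition graph k (F : {linear ext k.+1 V -> V}) (e : 'End(V) * ext k V) :
  Prop := exists x : ext k V, e = (sharp F x, x).

End Induced.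

Section Leibniz.
Variables (K : fieldType) (E : lmodType K) (br : E -> E -> E).

Definition bilinear_bracket : Prop :=
  (forall e, linear (br e)) /\ (forall e, linear (br^~ e)).

Definition leibniz_algebra : Prop := bilinear_bracket /\
  forall e1 e2 e3, br e1 (br e2 e3) = br (br e1 e2) e3 + br e2 (br e1 e3).

Definition linear_subspace (S : E -> Prop) : Prop :=
  S 0 /\ forall a x y, S x -> S y -> S (a *: x + y).

Definition leibniz_subalgebra (S : E -> Prop) : Prop :=
  linear_subspace S /\ forall x y, S x -> S y -> S (br x y).

End Leibniz.

Section NLie.
Variables (K : fieldType) (V : lmodType K) (k : nat).

(* The bracket has arity k + 1: [u_1, ..., u_k, w] is [br (frcons u w)]. *)
Definition fundamental_identity (br : {ffun 'I_k.+1 -> V} -> V) : Prop :=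
  forall (u : {ffun 'I_k -> V}) (v : {ffun 'I_k.+1 -> V}),
    br (frcons u (br v)) =
    \sum_(i < k.+1) br (upd v i (br (frcons u (v i)))).

Definition nLie_algebra (br : {ffun 'I_k.+1 -> V} -> V) : Prop :=
  [/\ multilinear br, alternating br & fundamental_identity br].

End NLie.

Section OmniLeibniz.
Variables (K : fieldType) (V : vectType K) (k : nat).

Lemma ext_deriv_linearl (x : ext k V) : linear (fun A => ext_deriv A x).
Proof.
move=> a A B; apply: (@eq_ext_linear K k V _ (ext_deriv (a *: A + B))
  (a \*: ext_deriv A \+ ext_deriv B : {linear _ -> _})) => v /=.
rewrite !ext_deriv_wedge scaler_sumr -big_split /=; apply: eq_bigr => i _.
by rewrite add_lfunE scale_lfunE wedge_multilinear.
Qed.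

Lemma ext_deriv_commutator (A B : 'End(V)) (x : ext k V) :
  ext_deriv A (ext_deriv B x) =
  ext_deriv (commutator A B) x + ext_deriv B (ext_deriv A x).
Proof.
apply: (@eq_ext_linear K k V _ (ext_deriv A \o ext_deriv B : {linear _ -> _})
  (ext_deriv (commutator A B) \+ (ext_deriv B \o ext_deriv A)
     : {linear _ -> _})) => v /=.
rewrite !ext_deriv_wedge !linear_sum /=.
under eq_bigr => i _ do rewrite ext_deriv_wedge (bigD1 i) //= upd_upd upd_eq.
under [X in _ = _ + X]eq_bigr => i _
  do rewrite ext_deriv_wedge (bigD1 i) //= upd_upd upd_eq.
rewrite !big_split /= addrA; congr (_ + _).
  rewrite -big_split /=; apply: eq_bigr => i _; rewrite -(multilinearD (@wedge_multilinear K k V)).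
  by rewrite commutatorE addrNK.
rewrite (exchange_big_dep predT) //=; apply: eq_bigr => i _.
apply: eq_big => [j|j nij]; first by rewrite eq_sym.
have nji : j != i by rewrite eq_sym.
by rewrite !updE (negPf nij) (negPf nji) (updC _ _ _ nij).
Qed.

Theorem omni_leibniz : leibniz_algebra (@omni_bracket K V k).
Proof.
split; last first.
  move=> [A x] [B y] [C z]; rewrite /omni_bracket /=; congr (_, _); last first.
    exact: ext_deriv_commutator.
  apply/lfunP => v; rewrite [RHS]add_lfunE !commutatorE.
  rewrite (linearB A) (linearB B) (linearB C) /= !opprB.
  by rewrite [RHS]addrACA !subrKA addrACA [RHS]addrACA [- _ - _]addrC.
split=> [[A x] a [B y] [C z]|[C z] a [A x] [B y]].
- congr (_, _) => /=; last exact: ext_deriv_linear.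
  apply/lfunP => v; rewrite [RHS]add_lfunE scale_lfunE !commutatorE.
  by rewrite !add_lfunE !scale_lfunE linearP scalerBr opprD addrACA.
- congr (_, _) => /=; last exact: ext_deriv_linearl.
  apply/lfunP => v; rewrite [RHS]add_lfunE scale_lfunE !commutatorE.
  by rewrite !add_lfunE !scale_lfunE linearP scalerBr opprD addrACA.
Qed.

End OmniLeibniz.

(* Main.v *)
From HB Require Import structures.
Require Import Defs.
From mathcomp Require Import all_boot all_order all_algebra.

(** Write [D_x] for the endomorphism [sharp F x : u |-> F (x /\ u)].  Two
    reformulations turn the two sides of the equivalence into facts about how
    [D_x] interacts with [F].

    Since [L_A] is defined by the Leibniz rule on decomposable vectors, the
    fundamental identity says that [D_x] is a derivation of [F], that is
    [D_x (F z) = F (L_(D_x) z)], when [x] and [z] are decomposable; both sides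
    are linear in [x] and in [z], hence it says so for all [x] and [z]
    ([fundamental_identity_sharpP]).

    The bracket of two elements of the graph has first component [[D_x, D_y]]
    and second component [L_(D_x) y], so it lies in the graph exactly when
    [[D_x, D_y] = D_(L_(D_x) y)] ([graph_subalgebraP]).

    Finally [L_A (y /\ u) = L_A y /\ u + y /\ A u] ([ext_deriv_wedger]) shows
    that the second equation, evaluated at [u], is the first one for
    [z = y /\ u]: the summand [F (y /\ D_x u)] of the derivation rule is
    [D_y (D_x u)] ([derivation_wedgerP]).  Elements of the form [y /\ u] span
    the exterior power, so the two equations are equivalent. *)

Set Implicit Arguments.
Unset Strict Implicit.
Unset Printing Implicit Defensive.

Import GRing.Theory.

Local Open Scope ring_scope.

Lemma frcons_surj (T : Type) k (v : {ffun 'I_k.+1 -> T}) :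
  v = frcons [ffun j => v (lift ord_max j)] (v ord_max).
Proof.
apply/ffunP => i; case: (unliftP ord_max i) => [j ->|->].
  by rewrite frcons_lift ffunE.
by rewrite frcons_max.
Qed.

Section Graph.
Variables (K : fieldType) (V : vectType K).

(** An unbundled form of [eq_ext_linear]: below, the maps to be compared depend
    on their exterior argument through [sharp] or [wedger], which carry no
    canonical linear structure in that argument. *)
Lemma eq_on_wedge k (U : lmodType K) (f g : ext k V -> U) :
  linear f -> linear g -> (forall v, f (wedge v) = g (wedge v)) -> f =1 g.
Proof.
move=> f_lin g_lin.
pose Lf := GRing.isLinear.Build K _ _ _ f f_lin.
pose Lg := GRing.isLinear.Build K _ _ _ g g_lin.
pose f' : {linear ext k V -> U} := HB.pack f Lf.
pose g' : {linear ext k V -> U} := HB.pack g Lg.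
exact: (@eq_ext_linear K k V U f' g').
Qed.

Lemma wedgerPl k a (x y : ext k V) u :
  wedger (a *: x + y) u = a *: wedger x u + wedger y u.
Proof. exact: (@wedger_linearl K V k u). Qed.

(** On a decomposable [x] the vector [u] is the last factor of [x /\ u]; the
    last term of the sum defining [L_A] is then [x /\ A u], and the other terms
    make up [L_A x /\ u]. *)
Lemma ext_deriv_wedger k (A : 'End(V)) (x : ext k V) u :
  ext_deriv A (wedger x u) = wedger (ext_deriv A x) u + wedger x (A u).
Proof.
move: x; apply: eq_on_wedge => [a x y|a x y|v].
- by rewrite wedgerPl linearP.
- by rewrite linearP !wedgerPl scalerDr addrACA.
pose W := GRing.isLinear.Build K _ _ _ _ (@wedger_linearl K V k u).
pose G : {linear ext k V -> ext k.+1 V} := HB.pack ((@wedger K V k)^~ u) W.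
rewrite !wedger_wedge !ext_deriv_wedge -[wedger _ u]/(G _) linear_sum.
rewrite big_ord_recr /=.
congr (_ + _).
  apply: eq_bigr => i _; rewrite wedger_wedge frcons_upd.
  have -> : widen_ord (leqnSn k) i = lift ord_max i.
    by apply: val_inj; rewrite /= /bump leqNgt ltn_ord.
  by rewrite frcons_lift.
by rewrite frcons_max upd_frcons_max.
Qed.

Section Sharp.
Variables (k : nat) (F : {linear ext k.+1 V -> V}).

Lemma sharp_linear : linear (sharp F).
Proof.
move=> a x y; apply/lfunP => u.
by rewrite add_lfunE scale_lfunE !sharpE wedgerPl linearP.
Qed.

(** In this form the identity has no vectors left, only exterior elements, so
    it can be tested on any spanning family of the exterior power. *)
Lemma fundamental_identity_sharpP :
  fundamental_identity (fun v : {ffun 'I_k.+1 -> V} => F (wedge v)) <->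
  forall x z, sharp F x (F z) = F (ext_deriv (sharp F x) z).
Proof.
split=> [FI x|der u v]; last first.
  rewrite -wedger_wedge -sharpE der ext_deriv_wedge linear_sum.
  by apply: eq_bigr => i _; rewrite sharpE wedger_wedge.
apply: eq_on_wedge => [a y z|a y z|v]; [by rewrite !linearP.. | ].
move: x; apply: eq_on_wedge => [a x y|a x y|u].
- by rewrite sharp_linear add_lfunE scale_lfunE.
- by rewrite sharp_linear ext_deriv_linearl linearP.
rewrite sharpE wedger_wedge FI ext_deriv_wedge linear_sum.
by apply: eq_bigr => i _; rewrite sharpE wedger_wedge.
Qed.

(** An element of the graph is determined by its exterior component, so being
    closed under the bracket leaves one equation in [gl(V)]; being a linear
    subspace is automatic because [sharp F] is linear. *)
Lemma graph_subalgebraP :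
  leibniz_subalgebra (@omni_bracket K V k) (graph F) <->
  forall x y, commutator (sharp F x) (sharp F y) =
              sharp F (ext_deriv (sharp F x) y).
Proof.
split=> [[_ clos] x y|closF].
  have [|| z [comE ->]] := clos (sharp F x, x) (sharp F y, y).
  - by exists x.
  - by exists y.
  by [].
split; last by move=> _ _ [x ->] [y ->]; eexists; congr (_, _); apply: closF.
split=> [|a _ _ [x ->] [y ->]].
  have := sharp_linear (-1) 0 0; rewrite scaler0 addr0 scaleN1r addNr => sharp0.
  by exists 0; rewrite sharp0.
by exists (a *: x + y); rewrite sharp_linear.
Qed.

(** By [ext_deriv_wedger] the right-hand side of the derivation rule is
    [D_(L_(D_x) y) u + D_y (D_x u)]; moving the second summand to the left
    produces the commutator. *)
Lemma derivation_wedgerP x y u :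
  sharp F x (F (wedger y u)) = F (ext_deriv (sharp F x) (wedger y u)) <->
  commutator (sharp F x) (sharp F y) u = sharp F (ext_deriv (sharp F x) y) u.
Proof.
rewrite ext_deriv_wedger linearD commutatorE -!(sharpE F).
by split=> [->|<-]; rewrite ?addrK ?subrK.
Qed.

End Sharp.

End Graph.

(* The integer n >= 2 of the informal statement is m.+2. *)
Theorem theorem3p4 (K : fieldType) (V : vectType K) (m : nat)
    (F : {linear ext m.+2 V -> V}) :
  nLie_algebra (fun v : {ffun 'I_m.+2 -> V} => F (wedge v)) <->
  leibniz_subalgebra (@omni_bracket K V m.+1) (graph F).
Proof.
apply: iff_trans (iff_sym (graph_subalgebraP F)).
split=> [[_ _ /fundamental_identity_sharpP der] x y|clos].
  by apply/lfunP => u; apply/derivation_wedgerP.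
split=> [v i a x y|v i j nij vij|].
- by rewrite wedge_multilinear linearP.
- by rewrite (wedge_alternating nij vij) linear0.
apply/fundamental_identity_sharpP => x.
apply: eq_on_wedge => [a y z|a y z|v]; [by rewrite !linearP.. | ].
rewrite (frcons_surj v) -wedger_wedge.
by apply/derivation_wedgerP; rewrite clos.
Qed.
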